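(* Let $r,s,\alpha$ be fixed positive integers with $r>s$, and let $\chi=\chi(\mathcal{KG}^{(\alpha+1)}(r,r-s))$ be the chromatic number of the Kneser hypergraph $\mathcal{KG}^{(\alpha+1)}(r,r-s)$. Let $\mathcal F_p$ be the family of all paths and $\mathcal F_c$ the family of all cycles. Then, as $n\to\infty$, $$\Omega(n^{1/\chi})\ \le\ c_{r,s,\alpha}(n,\mathcal F_p)\ \le\ c_{r,s,\alpha}(n,\mathcal F_c)\ \le\ O(n^{1/\chi}),$$ where the implied constants depend only on $r,s,\alpha$; that is, there exist constants $c,C>0$ depending only on $r,s,\alpha$ such that $c\,n^{1/\chi}\le c_{r,s,\alpha}(n,\mathcal F_p)\le c_{r,s,\alpha}(n,\mathcal F_c)\le C\,n^{1/\chi}$ for all sufficiently large $n$.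
   Context: All graphs are finite and simple; $[r]=\{1,\dots,r\}$. An $r$-colouring of the edges of a graph $G$ is an arbitrary map $E(G)\to[r]$. Single vertices and single edges are regarded as degenerate cycles, so $\mathcal F_c$ consists of $K_1$, $K_2$ and all cycles on at least $3$ vertices. The family $\mathcal F_p$ consists of all paths on at least one vertex (a single vertex is a path). Let $\mathcal F$ be a family of graphs. A subgraph (not necessarily induced) of an edge-coloured graph is monochromatic if all its edges have the same colour. Subgraphs without edges are monochromatic and use no colour. A monochromatic $\mathcal F$-covering of an edge-coloured graph $G$ is a collection $\mathbf S$ of monochromatic subgraphs of $G$, each isomorphic to a graph in $\mathcal F$, such that every vertex of $G$ belongs to at least one subgraph in $\mathbf S$ (the subgraphs need not be disjoint). $|\mathbf S|$ is the number of subgraphs in the collection, and $\mathrm{col}(\mathbf S)$ is the total number of different colours appearing on edges of subgraphs in $\mathbf S$. For a graph $G$, $c_{r,s}(G,\mathcal F)$ is the smallest number $k$ such that every $r$-colouring of the edges of $G$ admits a monochromatic $\mathcal F$-covering $\mathbf S$ with $|\mathbf S|\le k$ and $\mathrm{col}(\mathbf S)\le s$. Further, $$c_{r,s,\alpha}(n,\mathcal F)=\max\{c_{r,s}(G,\mathcal F): |V(G)|=n,\ \alpha(G)\le\alpha\},$$ where $\alpha(G)$ is the independence number of $G$. The Kneser hypergraph $\mathcal{KG}^{(\alpha+1)}(r,r-s)$ is the $(\alpha+1)$-uniform hypergraph with vertex set $\{X\subseteq[r]:|X|=r-s\}$ in which vertices $X_1,\dots,X_{\alpha+1}$ form a hyperedge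 if and only if they are pairwise disjoint as subsets of $[r]$. The chromatic number of a hypergraph is the least number of colours in a vertex colouring with no hyperedge having all its vertices of the same colour (so it equals $1$ if there are no hyperedges). *)

(* Defs.v *)
(* MathComp, with MathComp-Analysis for classical choice (and, in the
   theorem, for the real numbers and real powers). *)
From mathcomp Require Import all_boot.
From mathcomp Require Import boolp.
From mathcomp Require classical_sets.

Set Implicit Arguments.
Unset Strict Implicit.
Unset Printing Implicit Defensive.

(* [least P] and [greatest P] are 0 when the extremum does not exist; the
   lemmas [cover_numberP], [max_cover_numberP] and [chromatic_numberP] (with
   [kneser_hyperedge_gt1]) show that this is never the case in the theorem. *)
Definition is_least (P : nat -> Prop) (k : nat) : Prop :=
  P k /\ forall j, P j -> k <= j.

Definition is_greatest (P : nat -> Prop) (k : nat) : Prop :=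
  P k /\ forall j, P j -> j <= k.

Definition least (P : nat -> Prop) : nat := 
  classical_sets.xget 0 (is_least P).

Definition greatest (P : nat -> Prop) : nat := 
  classical_sets.xget 0 (is_greatest P).

Lemma leastP (P : nat -> Prop) : (exists k, P k) -> is_least P (least P).
Proof.
move=> [k Pk]; have exP : exists k, `[< P k >] by exists k; apply/asboolP.
apply: (classical_sets.xgetPex 0); case: (ex_minnP exP) => m /asboolP Pm min_m.
by exists m; split=> // j Pj; apply/min_m/asboolP.
Qed.

Lemma greatestP (P : nat -> Prop) (b : nat) :
  (exists k, P k) -> (forall k, P k -> k <= b) -> is_greatest P (greatest P).
Proof.
move=> [k Pk] leb; have exP : exists k, `[< P k >] by exists k; apply/asboolP.
have ub j : `[< P j >] -> j <= b by move=> /asboolP; apply: leb.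
apply: (classical_sets.xgetPex 0); case: (ex_maxnP exP ub) => m /asboolP Pm max_m.
by exists m; split=> // j Pj; apply/max_m/asboolP.
Qed.

Record graph := Graph {
  vertex :> finType;
  adj : rel vertex;
  adj_sym : symmetric adj;
  adj_irr : irreflexive adj }.

Definition isomorphic (G H : graph) : Prop :=
  exists2 f : G -> H, bijective f & forall x y, adj (f x) (f y) = adj x y.

Definition edges (G : graph) : {set {set G}} :=
  [set [set p.1; p.2] | p : G * G & adj p.1 p.2].

Definition edge (G : graph) := {e : {set G} | e \in edges G}.

Definition independent (G : graph) (A : {set G}) : bool :=
  [forall x in A, forall y in A, ~~ adj x y].

Definition independence_number (G : graph) : nat :=
  \max_(A : {set G} | independent A) #|A|.

Definition complete_adj n : rel 'I_n := fun i j => i != j.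

Lemma complete_adj_sym n : symmetric (@complete_adj n).
Proof. by move=> i j; rewrite /complete_adj eq_sym. Qed.

Lemma complete_adj_irr n : irreflexive (@complete_adj n).
Proof. by move=> i; rewrite /complete_adj eqxx. Qed.

Definition complete_graph n : graph :=
  Graph (@complete_adj_sym n) (@complete_adj_irr n).

Definition path_adj n : rel 'I_n :=
  fun i j => (i.+1 == j :> nat) || (j.+1 == i :> nat).

Lemma path_adj_sym n : symmetric (@path_adj n).
Proof. by move=> i j; rewrite /path_adj orbC. Qed.

Lemma path_adj_irr n : irreflexive (@path_adj n).
Proof. by move=> i; rewrite /path_adj orbb gtn_eqF. Qed.

Definition path_graph n : graph :=
  Graph (@path_adj_sym n) (@path_adj_irr n).

(* The conjunct [i != j] only matters for n = 1. *)
Definition cycle_adj n : rel 'I_n :=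
  fun i j =>
    (i != j) && ((i.+1 %% n == j :> nat) || (j.+1 %% n == i :> nat)).

Lemma cycle_adj_sym n : symmetric (@cycle_adj n).
Proof. by move=> i j; rewrite /cycle_adj eq_sym orbC. Qed.

Lemma cycle_adj_irr n : irreflexive (@cycle_adj n).
Proof. by move=> i; rewrite /cycle_adj eqxx. Qed.

Definition cycle_graph n : graph :=
  Graph (@cycle_adj_sym n) (@cycle_adj_irr n).

Definition family := graph -> Prop.

Definition Fpaths : family :=
  fun H => exists2 n, 1 <= n & isomorphic H (path_graph n).

Definition Fcycles : family :=
  fun H => [\/ isomorphic H (complete_graph 1),
               isomorphic H (complete_graph 2) |
               exists2 n, 3 <= n & isomorphic H (cycle_graph n)].

(* A pair (vertex set, edge set); only those satisfying [is_subgraph] are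
   subgraphs of G. *)
Definition presubgraph (G : graph) := ({set G} * {set {set G}})%type.

Definition is_subgraph (G : graph) (H : presubgraph G) : Prop :=
  H.2 \subset edges G /\ cover H.2 \subset H.1.

(* The conjunct [x != y] is redundant when [is_subgraph H] holds. *)
Definition sub_adj (G : graph) (H : presubgraph G) : rel {x : G | x \in H.1} :=
  fun x y => (x != y) && ([set val x; val y] \in H.2).

Lemma sub_adj_sym (G : graph) (H : presubgraph G) : symmetric (@sub_adj G H).
Proof. by move=> x y; rewrite /sub_adj eq_sym setUC. Qed.

Lemma sub_adj_irr (G : graph) (H : presubgraph G) : irreflexive (@sub_adj G H).
Proof. by move=> x; rewrite /sub_adj eqxx. Qed.

Definition graph_of_sub (G : graph) (H : presubgraph G) : graph :=
  Graph (@sub_adj_sym G H) (@sub_adj_irr G H).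

Definition monochromatic r (G : graph) (c : edge G -> 'I_r)
    (H : presubgraph G) : Prop :=
  forall e1 e2 : edge G, val e1 \in H.2 -> val e2 \in H.2 -> c e1 = c e2.

Definition mono_covering r (G : graph) (c : edge G -> 'I_r) (F : family)
    (S : {set presubgraph G}) : Prop :=
  (forall H, H \in S ->
     [/\ is_subgraph H, monochromatic c H &
         exists2 K, F K & isomorphic (graph_of_sub H) K]) /\
  (forall x : G, exists2 H, H \in S & x \in H.1).

Definition col r (G : graph) (c : edge G -> 'I_r)
    (S : {set presubgraph G}) : nat :=
  #|[set c e | e : edge G & [exists H in S, val e \in H.2]]|.

Definition coverable r s (G : graph) (F : family) (k : nat) : Prop :=
  forall c : edge G -> 'I_r, exists S : {set presubgraph G},
    [/\ mono_covering c F S, #|S| <= k & col c S <= s].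

Definition cover_number r s (G : graph) (F : family) : nat :=
  least (coverable r s G F).

Definition cover_value r s alpha n (F : family) (k : nat) : Prop :=
  exists G : graph,
    [/\ #|G| = n, independence_number G <= alpha & k = cover_number r s G F].

Definition max_cover_number r s alpha n (F : family) : nat :=
  greatest (cover_value r s alpha n F).

Record hypergraph := Hypergraph {
  hvertex :> finType;
  hyperedge : {set {set hvertex}} }.

Definition proper_colouring (K : hypergraph) k (f : K -> 'I_k) : Prop :=
  forall e, e \in hyperedge K -> ~ exists a, forall x, x \in e -> f x = a.

Definition chromatic_number (K : hypergraph) : nat :=
  least (fun k => exists f : K -> 'I_k, proper_colouring f).

(* For m > 0, pairwise disjoint m-sets X_1, ..., X_k are automatically
   distinct, so hyperedges may be encoded as k-element sets of vertices. *)
Definition kneser_vertex r m := {X : {set 'I_r} | #|X| == m}.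

Definition kneser_hypergraph k r m : hypergraph :=
  @Hypergraph (kneser_vertex r m)
    [set e : {set kneser_vertex r m} | (#|e| == k) &&
       [forall X in e, forall Y in e, (X != Y) ==> [disjoint val X & val Y]]].

Lemma coverable_card r s (G : graph) (F : family) :
  F (complete_graph 1) -> coverable r s G F #|G|.
Proof.
move=> FK1 c; exists [set ([set x], set0 : {set {set G}}) | x : G].
split; last 2 first.
- exact: leq_imset_card.
- rewrite /col (_ : [set _ | _ in _] = set0) ?cards0 //.
  apply/setP => a; rewrite !inE; apply/negbTE/imsetP => -[e].
  by rewrite inE => /existsP[H /andP[/imsetP[x _ ->]]]; rewrite inE.
split=> [_ /imsetP[x _ ->]|x]; last first.
  by exists ([set x], set0); rewrite ?inE //; apply/imsetP; exists x.
split; first by split; rewrite ?sub0set // /cover big_set0 sub0set.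
  by move=> e1 e2; rewrite inE.
exists (complete_graph 1) => //.
have xx : x \in [set x] by rewrite inE.
have all_eq (u : {y : G | y \in [set x]}) : u = exist _ x xx.
  by case: u => y yx; apply: val_inj; apply/set1P.
exists (fun=> ord0 : 'I_1) => [|u v /=]; last first.
  by rewrite /complete_adj /sub_adj (all_eq u) (all_eq v) !eqxx.
by exists (fun=> exist _ x xx) => [u|i]; rewrite ?(all_eq u) ?(ord1 i).
Qed.

Lemma cover_numberP r s (G : graph) (F : family) :
  F (complete_graph 1) ->
  is_least (coverable r s G F) (cover_number r s G F).
Proof. by move=> FK1; apply: leastP; exists #|G|; apply: coverable_card. Qed.

Lemma max_cover_numberP r s alpha n (F : family) :
  0 < alpha -> F (complete_graph 1) ->
  is_greatest (cover_value r s alpha n F) (max_cover_number r s alpha n F).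
Proof.
move=> alpha0 FK1; apply: (greatestP (b := n)) => [|_ [G [<- _ ->]]]; last first.
  by have [_] := cover_numberP r s G FK1; apply; apply: coverable_card.
exists (cover_number r s (complete_graph n) F); exists (complete_graph n).
split; rewrite ?card_ord //; apply/bigmax_leqP => A indA.
apply: leq_trans alpha0; apply/card_le1_eqP => x y xA yA; apply/eqP.
move/forall_inP/(_ x xA)/forall_inP/(_ y yA): indA.
by rewrite negbK eq_sym.
Qed.

Lemma chromatic_numberP (K : hypergraph) :
  (forall e, e \in hyperedge K -> 1 < #|e|) ->
  is_least (fun k => exists f : K -> 'I_k, proper_colouring f)
    (chromatic_number K).
Proof.
move=> e2; apply: leastP; exists #|K|; exists enum_rank => e /e2.
move=> /card_gt1P[x [y [xe ye]]] /eqP + [a ea]; apply.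
by apply: enum_rank_inj; rewrite !ea.
Qed.

Lemma Fpaths_K1 : Fpaths (complete_graph 1).
Proof.
exists 1 => //; exists id; first by exists id.
by move=> i j; rewrite /= /path_adj /complete_adj (ord1 i) (ord1 j).
Qed.

Lemma Fcycles_K1 : Fcycles (complete_graph 1).
Proof. by constructor 1; exists id => //; exists id. Qed.

Lemma kneser_hyperedge_gt1 alpha r m (e : {set kneser_vertex r m}) :
  0 < alpha -> e \in hyperedge (kneser_hypergraph alpha.+1 r m) -> 1 < #|e|.
Proof. by move=> alpha0; rewrite inE => /andP[/eqP->]. Qed.

(* Main.v *)
Require Import Defs.
From mathcomp Require Import all_boot all_order all_algebra.
From mathcomp Require Import boolp reals exp.
From mathcomp Require Import zify.
Import Order.TTheory GRing.Theory Num.Theory.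

(** The exponent comes from a scale argument on both sides. Let [K] be the
    Kneser hypergraph, [chi] its chromatic number, and read a vertex [Y] of [K]
    as the set of the r - s colours that a covering does without.

    Lower bound. A proper colouring of [K] by levels 0, ..., chi - 1 gives a
    layered graph: each [Y] of level j receives a clique of about t^(j+1)
    vertices, where t^chi is about n; two cliques on different levels are
    completely joined, and two on the same level are joined when their sets
    meet. The colour of an edge is taken in the set of its lower end, and in
    both sets when the levels agree. Independent vertices therefore lie on one
    level and have pairwise disjoint sets, so properness bounds the independence
    number by alpha. A covering with at most s colours misses some [Y]
    completely; its paths can only leave the clique of [Y] towards lower levels,
    which have O(t^j) vertices in all, so each path covers O(t^j) of the t^(j+1)
    vertices of the clique, and about t paths are necessary
    ([layered_covering_size], [cover_number_lower_bound]).

    Upper bound. Let t^chi >= n. For each [Y], let [U Y] be the set of vertices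
    missed by a partial covering with cycles whose colours lie outside [Y], taken
    as small as possible among those that have spent few cycles for the progress
    made. Suppose that every [U Y] has more than t elements. The scale q with
    t^q < #|U Y| <= t^(q+1) takes at most chi - 1 values, too few for a proper
    colouring of [K]: some alpha + 1 pairwise disjoint sets have a common scale
    q. Choose t^q vertices in each of their [U Y]. There is no independent
    transversal of the chosen sets, so two of them span a positive density of
    edges ([sparse_transversal], [dense_colour_pair]). A popular colour a among
    these edges lies outside one of the two disjoint sets, say [Y], and the dense
    graph of colour a contains a long cycle, which covers at least t^q / D
    vertices of [U Y] for a constant D ([dense_pair_cycle],
    [exists_long_cycle_step]). Sets at scale q have at most t^(q+1) elements, so
    D t cycles of this kind suffice to leave the scale; hence the longer partial
    covering is still economical, against the choice of [U Y]. [potential] does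
    the bookkeeping. So some [U Y] has at most t elements, which are covered one
    by one, for O(t) cycles in total ([cover_number_upper_bound]).

    Deleting an edge from each cycle compares paths with cycles. *)

Set Implicit Arguments.
Unset Strict Implicit.
Unset Printing Implicit Defensive.

(** * Cardinalities of finite sets *)

Lemma subset_of_card (T : finType) (A : {set T}) n :
  n <= #|A| -> exists2 B : {set T}, B \subset A & #|B| = n.
Proof.
rewrite -bin_gt0 -cards_draws card_gt0 => /set0Pn[B].
by rewrite inE => /andP[BA /eqP]; exists B.
Qed.

Lemma leq_card_bigcup_sum (I T : finType) (P : pred I) (F : I -> {set T}) :
  #|\bigcup_(i | P i) F i| <= \sum_(i | P i) #|F i|.
Proof.
elim/big_rec2: _ => [|i x A _ IH]; first by rewrite cards0.
by apply: leq_trans (leq_card_setU _ _) _; rewrite leq_add2l.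
Qed.

Lemma leq_card_bigcup (I T : finType) (P : pred I) (F : I -> {set T}) h :
  (forall i, P i -> #|F i| <= h) -> #|\bigcup_(i | P i) F i| <= #|P| * h.
Proof.
move=> Fh; rewrite -sum_nat_const.
by apply: leq_trans (leq_card_bigcup_sum _ _) _; apply: leq_sum.
Qed.

Lemma set2_eqP (T : finType) (a b x y : T) :
  [set a; b] = [set x; y] -> (a = x /\ b = y) \/ (a = y /\ b = x).
Proof.
move=> E.
have : (a \in [set x; y]) /\ (b \in [set x; y]) by rewrite -E !inE !eqxx orbT.
have : (x \in [set a; b]) /\ (y \in [set a; b]) by rewrite E !inE !eqxx orbT.
rewrite !inE => -[/orP[]/eqP-> /orP[]/eqP->] [/orP[]/eqP? /orP[]/eqP?]; subst; auto.
Qed.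

(** * Subgraphs given by embeddings *)

Lemma isomorphic_refl G : isomorphic G G.
Proof. by exists id => //; exists id. Qed.

Lemma isomorphic_sym G H : isomorphic G H -> isomorphic H G.
Proof.
move=> [f [g fK gK] fadj]; exists g; first by exists f.
by move=> x y; rewrite -fadj !gK.
Qed.

Lemma isomorphic_trans H G K :
  isomorphic G H -> isomorphic H K -> isomorphic G K.
Proof.
move=> [f fbij fadj] [g gbij gadj]; exists (g \o f); first exact: bij_comp.
by move=> x y; rewrite /= gadj fadj.
Qed.

Lemma edgesE (G : graph) (x y : G) : ([set x; y] \in edges G) = adj x y.
Proof.
apply/imsetP/idP => [[[u v]]|xy]; last by exists (x, y); rewrite ?inE.
rewrite inE /= => uv /set2_eqP[[-> ->]|[-> ->]] //.
by rewrite adj_sym.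
Qed.

Lemma edgesP (G : graph) (A : {set G}) :
  A \in edges G -> exists x y, [/\ adj x y, x != y & A = [set x; y]].
Proof.
case/imsetP => -[x y] /=; rewrite inE /= => xy ->; exists x, y; split => //.
by apply: contraTneq xy => ->; rewrite adj_irr.
Qed.

(** The image of [K] in [G]. All paths and cycles below arise in this way, so
    that the isomorphism type has to be checked only once. *)
Definition embed (K G : graph) (g : K -> G) : presubgraph G :=
  ([set g i | i : K], [set [set g p.1; g p.2] | p : K * K & adj p.1 p.2]).

Lemma embed_edgeE (K G : graph) (g : K -> G) i j :
  injective g -> ([set g i; g j] \in (embed g).2) = adj i j.
Proof.
move=> ginj; apply/imsetP/idP => [[[u v]]|ij]; last by exists (i, j); rewrite ?inE.
rewrite inE /= => uv /set2_eqP[[/ginj-> /ginj->]|[/ginj-> /ginj->]] //.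
by rewrite adj_sym.
Qed.

Lemma embed_isomorphic (K G : graph) (g : K -> G) :
  injective g -> isomorphic (graph_of_sub (embed g)) K.
Proof.
move=> ginj; apply: isomorphic_sym.
have gim i : g i \in (embed g).1 by apply: imset_f.
pose h i : graph_of_sub (embed g) := exist _ (g i) (gim i).
have hinj : injective h by move=> i j [/ginj].
exists h; last first.
  move=> i j; rewrite /= /sub_adj /= embed_edgeE // andb_idl // => ij.
  by rewrite (inj_eq hinj); apply: contraTneq ij => ->; rewrite adj_irr.
apply: inj_card_bij hinj _ => //=; rewrite card_sig -(card_imset predT ginj).
by apply/eq_leq/eq_card => x; rewrite inE.
Qed.

(** Reads a member of a covering as a vertex sequence: for a path or a cycle,
    [g] is indexed by an ordinal. *)
Lemma isomorphic_embedding (K G : graph) (H : presubgraph G) :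
  isomorphic (graph_of_sub H) K ->
  exists g : K -> G, [/\ injective g, [set g i | i : K] = H.1 &
    forall i j, adj i j -> [set g i; g j] \in H.2].
Proof.
move=> /isomorphic_sym[f fbij fadj]; exists (fun i => val (f i)); split.
- by move=> i j /val_inj /(bij_inj fbij).
- apply/setP => x; apply/imsetP/idP => [[i _ ->]|xH]; first exact: (valP (f i)).
  have [f' f'K fK] := fbij.
  by exists (f' (exist _ x xH)); rewrite ?fK.
- by move=> i j; rewrite -fadj => /andP[].
Qed.

Section Colours.
Variables (r : nat) (G : graph) (c : edge G -> 'I_r).

(** Colours are attached to two-element sets; this is their form as relations
    on vertices, which the combinatorial arguments use. *)
Definition colour_adj (a : 'I_r) : rel G :=
  fun x y => [exists e : edge G, (val e == [set x; y]) && (c e == a)].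

Lemma colour_adj_sym a : symmetric (colour_adj a).
Proof. by move=> x y; rewrite /colour_adj setUC. Qed.

Lemma colour_adjW a x y : colour_adj a x y -> adj x y.
Proof. by case/existsP => e /andP[/eqP exy _]; rewrite -edgesE -exy (valP e). Qed.

Lemma colour_adj_irr a : irreflexive (colour_adj a).
Proof. by move=> x; apply/negbTE/negP => /colour_adjW; rewrite adj_irr. Qed.

Lemma adj_colour x y : adj x y -> exists a, colour_adj a x y.
Proof.
rewrite -edgesE => xy; pose e : edge G := Sub [set x; y] xy; exists (c e).
by apply/existsP; exists e; rewrite /= !eqxx.
Qed.

Lemma colour_adj_fun a x y (e : edge G) :
  colour_adj a x y -> val e = [set x; y] -> c e = a.
Proof.
case/existsP => e' /andP[/eqP e'xy /eqP <-] exy; congr c; apply: val_inj.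
by rewrite e'xy exy.
Qed.

Section Embedding.
Variables (K : graph) (g : K -> G) (a : 'I_r).
Hypothesis g_hom : forall i j, adj i j -> colour_adj a (g i) (g j).

Lemma embed_subgraph : is_subgraph (embed g).
Proof.
split; apply/subsetP.
  by move=> A /imsetP[[i j] /=]; rewrite inE => /g_hom/colour_adjW + ->; rewrite edgesE.
move=> x /bigcupP[A /imsetP[[i j] /=]]; rewrite inE /= => _ ->.
by rewrite !inE => /orP[]/eqP->; apply: imset_f.
Qed.

Lemma embed_colour e : val e \in (embed g).2 -> c e = a.
Proof.
by case/imsetP=> -[i j] /=; rewrite inE => /g_hom; apply: colour_adj_fun.
Qed.

Lemma embed_monochromatic : monochromatic c (embed g).
Proof. by move=> e1 e2 /embed_colour-> /embed_colour->. Qed.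

End Embedding.
End Colours.

(** * Paths versus cycles *)

Lemma cycle_path_adj n (i j : 'I_n) : path_adj i j -> cycle_adj i j.
Proof.
move=> ij; apply/andP; split.
  by apply: contraTneq ij => ->; rewrite path_adj_irr.
by case/orP: ij => /eqP ij; apply/orP; [left|right]; rewrite ij modn_small.
Qed.

Lemma spanning_path n (h : rel 'I_n) (hs : symmetric h) (hi : irreflexive h)
    (G : graph) (H : presubgraph G) :
  0 < n -> is_subgraph H -> isomorphic (graph_of_sub H) (Graph hs hi) ->
  (forall i j, path_adj i j -> h i j) ->
  exists H' : presubgraph G, [/\ is_subgraph H', H'.1 = H.1, H'.2 \subset H.2 &
    exists2 K, Fpaths K & isomorphic (graph_of_sub H') K].
Proof.
move=> n_gt0 [HE HV] /isomorphic_embedding[g [ginj gim gadj]] hpath.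
have gpath i j : path_adj i j -> [set g i; g j] \in H.2 by move=> /hpath/gadj.
exists (@embed (path_graph n) G g); split=> //.
- split; apply/subsetP.
    by move=> A /imsetP[[i j] /=]; rewrite inE => /gpath + ->; apply/subsetP.
  move=> x /bigcupP[A /imsetP[[i j] /=]]; rewrite inE /= => _ ->.
  by rewrite !inE => /orP[]/eqP->; apply: imset_f.
- by apply/subsetP => A /imsetP[[i j] /=]; rewrite inE => /gpath + ->.
exists (path_graph n); first by exists n => //; apply: isomorphic_refl.
exact: embed_isomorphic.
Qed.

Lemma cycle_has_path (G : graph) (H : presubgraph G) K :
  is_subgraph H -> Fcycles K -> isomorphic (graph_of_sub H) K ->
  exists H' : presubgraph G, [/\ is_subgraph H', H'.1 = H.1, H'.2 \subset H.2 &
    exists2 K', Fpaths K' & isomorphic (graph_of_sub H') K'].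
Proof.
move=> Hsub FK HK; case: FK => [|| [n n_ge3]] /(isomorphic_trans HK) iK.
- apply: (spanning_path _ Hsub iK) => // i j.
  by rewrite (ord1 i) (ord1 j) path_adj_irr.
- apply: (spanning_path _ Hsub iK) => // i j.
  by apply: contraTneq => ->; rewrite path_adj_irr.
- apply: (spanning_path _ Hsub iK) => [|i j]; first exact: leq_trans n_ge3.
  exact: cycle_path_adj.
Qed.

Lemma coverable_cycles_paths r s (G : graph) k :
  coverable r s G Fcycles k -> coverable r s G Fpaths k.
Proof.
move=> cov c; have [S [[SH Scov] Sk Ss]] := cov c.
have /choice[h hP] (H : presubgraph G) : exists H' : presubgraph G, H \in S ->
    [/\ is_subgraph H', H'.1 = H.1, H'.2 \subset H.2 &
    exists2 K', Fpaths K' & isomorphic (graph_of_sub H') K'].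
  have [/SH[Hsub _ [K FK HK]]|_] := boolP (H \in S); last by exists H.
  by have [H' H'P] := cycle_has_path Hsub FK HK; exists H'.
exists [set h H | H in S]; split; last 2 first.
- exact: leq_trans (leq_imset_card _ _) Sk.
- apply: leq_trans Ss; apply/subset_leq_card/subsetP => a /imsetP[e].
  rewrite inE => /existsP[_ /andP[/imsetP[H HS ->] eh]] ->.
  apply: imset_f; rewrite inE; apply/existsP; exists H; rewrite HS /=.
  by have [_ _ /subsetP->] := hP H HS.
split=> [_ /imsetP[H HS ->]|x].
  have [h1 h2 /subsetP h3 h4] := hP H HS; have [_ Hmono _] := SH H HS.
  by split=> // e1 e2 /h3 He1 /h3 He2; apply: Hmono.
have [H HS xH] := Scov x; exists (h H); first exact: imset_f.
by have [_ -> _ _] := hP H HS.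
Qed.

Lemma max_cover_paths_le_cycles r s alpha n : 0 < alpha ->
  max_cover_number r s alpha n Fpaths <= max_cover_number r s alpha n Fcycles.
Proof.
move=> alpha0.
have [[G [nG aG ->]] _] := max_cover_numberP r s n alpha0 Fpaths_K1.
have [_ Cmax] := max_cover_numberP r s n alpha0 Fcycles_K1.
apply: (@leq_trans (cover_number r s G Fcycles)); last by apply: Cmax; exists G.
have [covG _] := cover_numberP r s G Fcycles_K1.
have [_] := cover_numberP r s G Fpaths_K1; apply.
exact: coverable_cycles_paths.
Qed.

(** * The lower bound *)

(** The extremal graph. A vertex labelled [Some Y] belongs to the clique of [Y],
    on the level [f Y]; vertices labelled [None] only bring the order up to n, on
    an extra top level [k] with all the colours in their palette. *)
Section LayeredGraph.

Variables (r m k : nat) (f : kneser_vertex r m -> 'I_k) (T : finType).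
Variable lab : T -> option (kneser_vertex r m).
Hypotheses (r_gt0 : 0 < r) (m_gt0 : 0 < m).

Definition level (v : T) : nat := if lab v is Some Y then f Y else k.

Definition palette (v : T) : {set 'I_r} :=
  if lab v is Some Y then val Y else setT.

Definition layer_adj : rel T := fun u v =>
  (u != v) && ((level u != level v) || (palette u :&: palette v != set0)).

Lemma layer_adj_sym : symmetric layer_adj.
Proof.
by move=> u v; rewrite /layer_adj eq_sym [_ == level v]eq_sym setIC.
Qed.

Lemma layer_adj_irr : irreflexive layer_adj.
Proof. by move=> u; rewrite /layer_adj eqxx. Qed.

Definition layered_graph : graph := Graph layer_adj_sym layer_adj_irr.

Lemma palette_neq0 v : palette v != set0.
Proof.
rewrite /palette; case: (lab v) => [Y|]; rewrite -card_gt0 ?cardsT ?card_ord //.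
by rewrite (eqP (valP Y)).
Qed.

Lemma level_filler u v : lab u = None -> level v = level u -> lab v = None.
Proof.
rewrite /level => ->; case: (lab v) => // Y fY.
by have := ltn_ord (f Y); rewrite fY ltnn.
Qed.

(** Independent vertices share their level and have pairwise disjoint palettes,
    so alpha + 1 of them would be a hyperedge on which [f] is constant. *)
Lemma layered_independence alpha : 0 < alpha ->
  @proper_colouring (kneser_hypergraph alpha.+1 r m) k f ->
  independence_number layered_graph <= alpha.
Proof.
move=> alpha_gt0 fproper; apply/bigmax_leqP => A Aind; rewrite leqNgt.
apply/negP => Abig.
have ind u v : u \in A -> v \in A -> u != v ->
    level u = level v /\ [disjoint palette u & palette v].
  move=> uA vA uv; move: Aind => /forall_inP/(_ _ uA)/forall_inP/(_ _ vA).
  rewrite /= /layer_adj uv negb_or !negbK => /andP[/eqP-> /eqP dis]; split=> //.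
  by rewrite -setI_eq0 dis.
have lab_some u : u \in A -> exists Y, lab u = Some Y.
  move=> uA; case labu: (lab u) => [Y|]; first by exists Y.
  have /card_gt1P[x [y [xA yA xy]]] : 1 < #|A| by apply: leq_trans Abig.
  have [v vA uv] : exists2 v, v \in A & u != v.
    by have [<-|ux] := eqVneq x u; [exists y|exists x => //; rewrite eq_sym].
  have [luv] := ind u v uA vA uv.
  have labv := level_filler labu (esym luv).
  rewrite /palette labu labv -setI_eq0 setIid -cards_eq0 cardsT card_ord.
  by move/eqP => r0; move: r_gt0; rewrite r0.
have [B BA Bcard] := subset_of_card Abig.
have [b bB] : exists b, b \in B by apply/set0Pn; rewrite -card_gt0 Bcard.
have [Y0 labb] := lab_some b (subsetP BA b bB).
pose Y v := odflt Y0 (lab v).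
have labY v : v \in B -> lab v = Some (Y v).
  by move=> /(subsetP BA)/lab_some[Y' E]; rewrite /Y E.
have Ydis u v : u \in B -> v \in B -> u != v ->
    [disjoint val (Y u) & val (Y v)].
  move=> uB vB uv.
  have [_] := ind u v (subsetP BA u uB) (subsetP BA v vB) uv.
  by rewrite /palette !labY.
have Yinj : {in B &, injective Y}.
  move=> u v uB vB Yuv; apply/eqP; apply: contraT => uv.
  have := Ydis u v uB vB uv; rewrite Yuv -setI_eq0 setIid -cards_eq0.
  by rewrite (eqP (valP (Y v))) -leqn0 leqNgt m_gt0.
apply: (fproper (Y @: B)).
  rewrite inE card_in_imset // Bcard eqxx /=.
  apply/forall_inP => _ /imsetP[u uB ->]; apply/forall_inP => _ /imsetP[v vB ->].
  apply/implyP => Yuv; apply: Ydis => //.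
  by apply: contraNneq Yuv => ->.
exists (f (Y b)) => _ /imsetP[u uB ->]; apply: val_inj => /=.
have [<-//|ub] := eqVneq u b.
have [] := ind u b (subsetP BA u uB) (subsetP BA b bB) ub.
by rewrite /level !labY.
Qed.

Definition layer_colour_ok (e : {set T}) (a : 'I_r) : bool :=
  [forall u in e, forall v in e, (u != v) && (level u <= level v) ==>
     (a \in palette u)].

(** An edge takes a colour from the palette of its lower end, and from both
    palettes when its ends are on the same level: a colour that is missing from
    the palette of a vertex can only lead to lower levels. *)
Lemma layer_colouring :
  exists c : edge layered_graph -> 'I_r, forall a u v,
    colour_adj c a u v -> level u <= level v -> a \in palette u.
Proof.
have /choice[c cP] (e : edge layered_graph) :
    exists a, layer_colour_ok (val e) a.
  have [x [y [xy _ ->]]] := edgesP (valP e).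
  wlog lxy : x y xy / level x <= level y.
    move=> IH; case/orP: (leq_total (level x) (level y)) => lxy; first exact: IH.
    by rewrite setUC; apply: IH => //; rewrite adj_sym.
  have [a ax ay] : exists2 a, a \in palette x &
      level x = level y -> a \in palette y.
    have [exy|nxy] := eqVneq (level x) (level y); last first.
      have /set0Pn[a ax] := palette_neq0 x.
      by exists a => // exy; rewrite exy eqxx in nxy.
    move: xy; rewrite /= /layer_adj exy eqxx /= => /andP[_ /set0Pn[a]].
    by rewrite inE => /andP[ax ay]; exists a.
  exists a; apply/forall_inP => u; rewrite !inE => ue; apply/forall_inP => v.
  rewrite !inE => ve; apply/implyP => /andP[uv luv].
  case/orP: ue => /eqP ue; first by rewrite ue.
  case/orP: ve => /eqP ve; last by rewrite ue ve eqxx in uv.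
  by subst; apply: ay; apply/eqP; rewrite eqn_leq lxy.
exists c => a u v uv luv; have /existsP[e /andP[/eqP euv /eqP <-]] := uv.
have /forall_inP/(_ u) := cP e; rewrite euv !inE eqxx => /(_ isT).
move=> /forall_inP/(_ v); rewrite !inE eqxx orbT luv andbT => /(_ isT)/implyP; apply.
by apply: contraTneq (colour_adjW uv) => ->; rewrite adj_irr.
Qed.

End LayeredGraph.

(** Along the path, each vertex of [V] but the last one of the path is followed
    by a vertex of [L], and distinct vertices have distinct successors. *)
Lemma path_sparse_set (G : graph) (H : presubgraph G) K (V L : {set G}) :
  Fpaths K -> isomorphic (graph_of_sub H) K ->
  (forall u v, [set u; v] \in H.2 -> u \in V -> v \in L) ->
  #|H.1 :&: V| <= #|L|.+1.
Proof.
case=> [[//|n] _ Kiso] HK VL.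
have [g [ginj gim gadj]] := isomorphic_embedding (isomorphic_trans HK Kiso).
(* The positions of V on the path, except possibly the last one. *)
pose P := [set i : 'I_n | g (widen_ord (leqnSn n) i) \in V].
have gP : (fun i : 'I_n => g (lift ord0 i)) @: P \subset L.
  apply/subsetP => v /imsetP[i]; rewrite inE => iV ->.
  apply: VL iV; apply: gadj.
  by rewrite /= /path_adj /= eqxx.
have Pcard : #|P| <= #|L|.
  apply: leq_trans (subset_leq_card gP); rewrite card_imset //.
  by apply: inj_comp ginj (@lift_inj _ _).
apply: leq_trans
  (_ : #|g ord_max |: (fun i => g (widen_ord (leqnSn n) i)) @: P| <= _); last first.
  apply: (@leq_trans (1 + #|P|)); last by rewrite add1n.
  by rewrite cardsU1 leq_add ?leq_b1 ?leq_imset_card.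
apply/subset_leq_card/subsetP => x; rewrite inE -gim => /andP[/imsetP[i _ ->] iV].
rewrite !inE; have [->|ine] := eqVneq i ord_max; first by rewrite eqxx.
have ltin : i < n.
  rewrite ltn_neqAle -ltnS ltn_ord andbT.
  by apply: contra ine => /eqP E; apply/eqP/val_inj.
have -> : i = widen_ord (leqnSn n) (Ordinal ltin) by apply: val_inj.
apply/orP; right; apply: imset_f; rewrite inE.
by congr (g _ \in V): iV; apply: val_inj.
Qed.

(** Some [Y] contains no colour in use, hence the vertices of its clique only
    have neighbours on lower levels within the paths. The lower cliques have at
    most t^(f Y) vertices each, so that [path_sparse_set] applies with few
    vertices in [L]. *)
Lemma layered_covering_size r s k (f : kneser_vertex r (r - s) -> 'I_k)
    (T : finType) (lab : T -> option (kneser_vertex r (r - s))) t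
    (c : edge (layered_graph f lab) -> 'I_r) S :
  0 < t -> s < r ->
  (forall Y, #|[set v | lab v == Some Y]| = t ^ (f Y).+1) ->
  (forall a u v, colour_adj c a u v -> level f lab u <= level f lab v ->
     a \in palette lab u) ->
  mono_covering c Fpaths S -> Defs.col c S <= s ->
  t <= #|S| * (#|{: kneser_vertex r (r - s)}|).+1.
Proof.
move=> t_gt0 s_lt_r block cP [SH Scov] Ss.
pose used := [set c e | e : edge (layered_graph f lab) & [exists H in S, val e \in H.2]].
(* The r - s colours that the covering does without. *)
have [Y0 Yused Ycard] : exists2 Y : {set 'I_r}, Y \subset ~: used & #|Y| = r - s.
  by apply: subset_of_card; rewrite cardsCs setCK card_ord leq_sub2l.
have [Y YE] : exists Y : kneser_vertex r (r - s), val Y = Y0.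
  by have Yp : #|Y0| == r - s by [rewrite Ycard]; exists (Sub Y0 Yp).
pose V := [set v | lab v == Some Y].
pose L := [set v | level f lab v < f Y].
have Lcard : #|L| <= #|{: kneser_vertex r (r - s)}| * t ^ f Y.
  have LV : L \subset \bigcup_(Z | f Z < f Y) [set v | lab v == Some Z].
    apply/subsetP => v; rewrite inE /level; case labv: (lab v) => [Z|] fZ.
      by apply/bigcupP; exists Z; rewrite // inE labv.
    by have := leq_trans fZ (ltnW (ltn_ord (f Y))); rewrite ltnn.
  apply: leq_trans (subset_leq_card LV) _.
  apply: leq_trans (leq_card_bigcup (h := t ^ f Y) _) _.
    by move=> Z ZY; rewrite block leq_pexp2l.
  by rewrite leq_mul2r max_card orbT.
have HV H : H \in S -> #|H.1 :&: V| <= #|L|.+1.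
  move=> HS; have [[Hedges _] _ [K FK HK]] := SH H HS.
  apply: (path_sparse_set FK HK) => u v uv.
  rewrite inE => /eqP labu; rewrite inE.
  have uvE : [set u; v] \in edges (layered_graph f lab) := subsetP Hedges _ uv.
  pose e : edge (layered_graph f lab) := Sub [set u; v] uvE.
  have eused : c e \in used.
    by apply: imset_f; rewrite inE; apply/existsP; exists H; rewrite HS.
  have ce : colour_adj c (c e) u v by apply/existsP; exists e; rewrite /= !eqxx.
  have -> : (f Y : nat) = level f lab u by rewrite /level labu.
  rewrite ltnNge; apply/negP => /(cP _ _ _ ce).
  rewrite /palette labu YE => /(subsetP Yused); rewrite inE.
  by rewrite eused.
have : t ^ (f Y).+1 <= #|S| * (#|{: kneser_vertex r (r - s)}|.+1 * t ^ f Y).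
  rewrite -block -/V.
  have VS : V \subset \bigcup_(H in S) (H.1 :&: V).
    apply/subsetP => x xV; have [H HS xH] := Scov x.
    by apply/bigcupP; exists H; rewrite // inE xH.
  apply: leq_trans (subset_leq_card VS) _; apply: leq_card_bigcup => H HS.
  apply: leq_trans (HV H HS) _.
  by rewrite mulSn addnC -addn1 leq_add // expn_gt0 t_gt0.
by rewrite expnS mulnA leq_mul2r expn_eq0 -[t == 0]negbK -lt0n t_gt0.
Qed.

Lemma cover_number_lower_bound r s alpha n t :
  0 < alpha -> s < r -> 0 < t ->
  let K := kneser_hypergraph alpha.+1 r (r - s) in
  #|K| * t ^ chromatic_number K <= n ->
  t <= max_cover_number r s alpha n Fpaths * #|K|.+1.
Proof.
move=> alpha_gt0 s_lt_r t_gt0 K tn.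
have hyp e : e \in hyperedge K -> 1 < #|e| by apply: kneser_hyperedge_gt1.
have [[f fproper] _] := chromatic_numberP hyp.
set chi := chromatic_number K in f fproper tn.
pose B := {Y : K & 'I_(t ^ (f Y).+1)}.
have Bn : #|{: B}| <= n.
  apply: leq_trans tn; rewrite card_tagged sumnE big_map big_enum /=.
  rewrite -sum_nat_const; apply: leq_sum => Y _; rewrite card_ord.
  by rewrite leq_pexp2l.
(* The right summand completes the cliques to exactly n vertices. *)
pose T := (B + 'I_(n - #|{: B}|))%type.
pose lab (v : T) : option K := if v is inl b then Some (tag b) else None.
have r_gt0 : 0 < r by apply: leq_ltn_trans s_lt_r.
have m_gt0 : 0 < r - s by rewrite subn_gt0.
pose G := layered_graph f lab.
have [c cP] := layer_colouring f lab r_gt0 m_gt0.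
have [_ Pmax] := max_cover_numberP r s n alpha_gt0 Fpaths_K1.
have GP : cover_number r s G Fpaths <= max_cover_number r s alpha n Fpaths.
  apply: Pmax; exists G; split=> //; last exact: layered_independence.
  by rewrite card_sum card_ord subnKC.
apply: leq_trans (_ : cover_number r s G Fpaths * #|K|.+1 <= _); last first.
  by rewrite leq_mul2r GP orbT.
have [covG _] := cover_numberP r s G Fpaths_K1.
have [S [Scov Sk Ss]] := covG c.
have block Y : #|[set v | lab v == Some Y]| = t ^ (f Y).+1.
  rewrite -[RHS]card_ord -(card_imset predT (f := fun i : 'I_(t ^ (f Y).+1) =>
     inl (Tagged (fun Y => 'I_(t ^ (f Y).+1)) i) : T)); last first.
    by move=> i j [] /eqP; rewrite -tag_eqE /tag_eq eqxx /= tagged_asE => /eqP.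
  apply: eq_card => v; rewrite inE; apply/eqP/imsetP => [|[i _ ->]] //.
  by case: v => [[Z i]|//] /= [<-]; exists i.
apply: leq_trans (layered_covering_size t_gt0 s_lt_r block cP Scov Ss) _.
by rewrite leq_mul2r Sk orbT.
Qed.

(** * Long cycles *)

Section LongCycles.
Variables (T : finType) (e : rel T).
Hypotheses (e_sym : symmetric e) (e_irr : irreflexive e).

(** The neighbours of an end of a longest path all lie on the path; joining that
    end to the farthest of them closes a cycle through all its neighbours. *)
Lemma min_degree_cycle (A : {set T}) d :
  0 < #|A| -> 0 < d -> (forall x, x \in A -> d <= #|[set y in A | e x y]|) ->
  exists p : seq T, [/\ uniq p, cycle e p & d < size p].
Proof.
move=> /card_gt0P[x0 x0A] d_gt0 degA.
pose P n := `[< exists x p,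
  [/\ uniq (x :: p), path e x p, all (mem A) (x :: p) & size p = n] >].
have exP : exists n, P n.
  by exists 0; apply/asboolP; exists x0, [::]; rewrite /= x0A.
have leP n : P n -> n <= #|T|.
  move=> /asboolP[x [p [/= /andP[_ up] _ _ <-]]].
  by rewrite -(card_uniqP up) max_card.
case: (ex_maxnP exP leP) => _ /asboolP[x [p [xp_uniq xp_path xp_A <-]]] pmax.
have nbr y : y \in A -> e x y -> y \in p.
  move=> yA xy; apply: contraT => yp.
  have /pmax : P (size p).+1.
    apply/asboolP; exists y, (x :: p); rewrite /= e_sym xy xp_path; split=> //.
      move: xp_uniq => /= ->; rewrite inE negb_or yp !andbT.
      by apply: contraTneq xy => ->; rewrite e_irr.
    by move: xp_A => /= ->; rewrite yA.
  by rewrite ltnn.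
have xA : x \in A by case/andP: xp_A.
have /card_gt0P[y0] := leq_trans d_gt0 (degA x xA).
rewrite inE => /andP[y0A xy0].
(* Reversing p makes the farthest neighbour the first one found. *)
have has_nbr : has (e x) (rev p).
  by apply/hasP; exists y0 => //; rewrite mem_rev nbr.
pose i := find (e x) (rev p).
pose q := drop i (rev p).
have q_nbr y : y \in A -> e x y -> y \in q.
  move=> yA xy; have: y \in rev p by rewrite mem_rev nbr.
  rewrite -{1}(cat_take_drop i (rev p)) mem_cat => /orP[ytake|//].
  have yi := ytake; rewrite -index_mem size_take in yi.
  have: index y (take i (rev p)) < i.
    by apply: leq_trans yi _; case: ifP => // /negbT; rewrite -leqNgt.
  move/(before_find x); rewrite -(nth_take _ (n0 := i)); last first.
    by apply: leq_trans yi _; case: ifP => // /negbT; rewrite -leqNgt.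
  by rewrite nth_index // xy.
have pq : p = rev q ++ rev (take i (rev p)).
  by rewrite -rev_cat cat_take_drop revK.
exists (x :: rev q); split.
- by move: xp_uniq; rewrite pq -cat_cons cat_uniq => /andP[].
- rewrite /= rcons_path; apply/andP; split.
    by move: xp_path; rewrite pq cat_path => /andP[].
  have iq : i < size (rev p) by rewrite -has_find.
  rewrite /q (drop_nth x iq) rev_cons last_rcons e_sym.
  exact: nth_find.
- rewrite /= size_rev ltnS; apply: leq_trans (degA x xA) _.
  apply: leq_trans (card_size q); apply/subset_leq_card/subsetP => y.
  by rewrite inE => /andP[]; apply: q_nbr.
Qed.

(** Deleting a vertex with fewer than [d] neighbours destroys fewer than [2 * d]
    ordered adjacent pairs, so this cannot go on until nothing is left. *)
Lemma dense_min_degree (A : {set T}) d :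
  (2 * d) * #|A| < #|[set p : T * T | [&& p.1 \in A, p.2 \in A & e p.1 p.2]]| ->
  exists2 B : {set T}, 0 < #|B| & forall x, x \in B -> d <= #|[set y in B | e x y]|.
Proof.
move: {2}#|A| (leqnn #|A|) => n; elim: n A => [|n IH] A leA.
  have A0 : A = set0 by apply/eqP; rewrite -cards_eq0 -leqn0.
  by rewrite A0 (_ : [set _ | _] = set0) ?cards0 //; apply/setP=> p; rewrite !inE.
case: (boolP [forall x in A, d <= #|[set y in A | e x y]|]) => [/forall_inP degA|].
  move=> dens; exists A => //; rewrite card_gt0; apply: contraTneq dens => A0.
  by rewrite A0 (_ : [set _ | _] = set0) ?cards0 //; apply/setP=> p; rewrite !inE.
case/forall_inPn => x xA; rewrite -ltnNge => degx dens.
apply: (IH (A :\ x)); first by rewrite (cardsD1 x A) xA in leA.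
rewrite (cardsD1 x A) xA in dens.
set Q := [set p | _] in dens *; set Q' := [set p | _].
pose N := [set y in A | e x y].
have QS : Q \subset Q' :|: ([set (x, y) | y in N] :|: [set (y, x) | y in N]).
  apply/subsetP => -[u v]; rewrite !inE /= => /and3P[uA vA uv].
  have [ux|ux] := eqVneq u x.
    by apply/orP; right; apply/orP; left; rewrite ux; apply: imset_f; rewrite inE vA -ux.
  have [vx|vx] := eqVneq v x; last by rewrite uA vA uv.
  apply/orP; right; apply/orP; right; rewrite vx; apply: imset_f.
  by rewrite inE uA e_sym -vx.
have QN := leq_trans (subset_leq_card QS) (leq_card_setU _ _).
have [N2 _] := leq_card_setU [set (x, y) | y in N] [set (y, x) | y in N].
have N1 : #|[set (x, y) | y in N]| <= #|N| by apply: leq_imset_card.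
have N1' : #|[set (y, x) | y in N]| <= #|N| by apply: leq_imset_card.
rewrite -/N /= in degx dens.
move: QN N2 N1 N1' degx dens; rewrite add1n mulnS; set a := 2 * d * _.
by move: a #|Q| #|Q'| #|N| #|_ :|: _| #|_| #|_| => *; lia.
Qed.

End LongCycles.

(** Of two consecutive vertices at least one is in [B]. For a cycle
    whose edges run between [U] and [V], this counts the vertices in [U] even when
    [U] and [V] overlap. *)
Lemma path_vertex_cover_count (T : eqType) (e : rel T) (B : pred T) x p :
  (forall u v, e u v -> B u || B v) -> path e x p ->
  size (x :: p) <= (2 * count B (x :: p)).+1.
Proof.
move=> eB.
(* The extra term B x makes the induction go through. *)
suff H : path e x p -> size (x :: p) + B x <= (2 * count B (x :: p)).+1.
  by move=> /H; apply: leq_trans; rewrite leq_addr.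
elim: p x => [|y p IH] x /=; first by case: (B x).
move=> /andP[/eB xy /IH] /=; case: (B x) (B y) xy => [] [] //=; lia.
Qed.

(** * Independent transversals *)

(** Greedy choice. In [W i], few vertices have [d] or more neighbours in some
    other [W j]; if such vertices are never chosen, each earlier choice forbids
    fewer than [d] vertices of [W i]. *)
Lemma sparse_transversal (I T : finType) (e : rel T) (E : {set I})
    (W : I -> {set T}) h d (x0 : T) :
  symmetric e ->
  (forall i j, i \in E -> j \in E -> i != j ->
     #|[set x in W i | d <= #|[set y in W j | e x y]|]| <= h) ->
  (forall i, i \in E -> #|E| * (h + d) < #|W i|) ->
  exists v : I -> T, (forall i, i \in E -> v i \in W i) /\
    {in E &, forall i j, i != j -> ~~ e (v i) (v j)}.
Proof.
move=> e_sym heavy bigW.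
pose light i x := [forall j in E, (i != j) ==> (#|[set y in W j | e x y]| < d)].
have greedy (s : seq I) : {subset s <= E} -> uniq s ->
    exists v : I -> T, (forall i, i \in s -> (v i \in W i) && light i (v i)) /\
    {in s &, forall i j, i != j -> ~~ e (v i) (v j)}.
  elim: s => [|i s IH] sE; first by exists (fun=> x0).
  case/andP => is_ /IH[j js|v [vW vind]]; first by apply: sE; rewrite inE js orbT.
  have iE : i \in E by apply: sE; rewrite mem_head.
  have sE' j : j \in s -> j \in E by move=> js; apply: sE; rewrite inE js orbT.
  (* A choice in bad1 would forbid too much later; bad2 is forbidden already. *)
  pose bad1 := \bigcup_(j in E | i != j) [set x in W i | d <= #|[set y in W j | e x y]|].
  pose bad2 := \bigcup_(j in s) [set x in W i | e (v j) x].
  have ij j : j \in s -> j != i by move=> js; apply: contraNneq is_ => <-.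
  have bad1P : #|bad1| <= #|E| * h.
    apply: leq_trans (leq_card_bigcup _) _; first by move=> j /andP[jE]; apply: heavy.
    by rewrite leq_mul2r; apply/orP; right; apply/subset_leq_card/subsetP => j /andP[].
  have bad2P : #|bad2| <= #|E| * d.
    apply: leq_trans (leq_card_bigcup (h := d) _) _.
      move=> j js; have /andP[_ /forall_inP/(_ i iE)] := vW j js.
      by rewrite ij //= => /ltnW.
    by rewrite leq_mul2r; apply/orP; right; apply/subset_leq_card/subsetP => j /sE'.
  have [x xW xbad] : exists2 x, x \in W i & x \notin bad1 :|: bad2.
    apply/subsetPn; apply/negP => /subset_leq_card.
    have [] := leq_card_setU bad1 bad2; have := bigW i iE; lia.
  move: xbad; rewrite inE negb_or => /andP[xbad1 xbad2].
  have xlight : light i x.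
    apply/forall_inP => j jE; apply/implyP => neij; rewrite ltnNge.
    by apply: contra xbad1 => dx; apply/bigcupP; exists j; rewrite ?jE // inE xW.
  have xind j : j \in s -> ~~ e (v j) x.
    by move=> js; apply: contra xbad2 => vx; apply/bigcupP; exists j; rewrite ?inE ?xW.
  exists (fun j => if j == i then x else v j); split.
    move=> j; rewrite inE; case: eqP => [-> _|_ /= js]; first by rewrite xW.
    exact: vW.
  move=> j l; rewrite !inE; case: (eqVneq j i) => [->|ji] /=.
    case: (eqVneq l i) => [->|li] //= _ ls _.
    by rewrite e_sym xind.
  case: (eqVneq l i) => [->|li] //= js; first by move=> _ _; apply: xind.
  exact: vind.
have [j||v [vW vind]] := greedy (enum E); rewrite ?enum_uniq ?mem_enum //.
exists v; split=> [i iE|i j iE jE].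
  by case/andP: (vW i (etrans (mem_enum _ _) iE)).
by apply: vind; rewrite mem_enum.
Qed.

(** * Dense monochromatic pairs *)

Lemma high_degree_count (T : finType) (e : rel T) (A B : {set T}) d :
  #|[set x in A | d <= #|[set y in B | e x y]|]| * d <=
  #|[set p : T * T | [&& p.1 \in A, p.2 \in B & e p.1 p.2]]|.
Proof.
rewrite -sum_nat_const.
apply: leq_trans (_ : \sum_(x in [set x in A | d <= #|[set y in B | e x y]|])
   #|[set y in B | e x y]| <= _).
  by apply: leq_sum => x; rewrite inE => /andP[].
under eq_bigr do rewrite -sum1_card.
rewrite pair_big_dep /= sum1_card; apply/subset_leq_card/subsetP => -[x y].
by rewrite unfold_in /= !inE /= => /andP[/andP[-> _]].
Qed.

Section DensePair.
Variables (r : nat) (G : graph) (c : edge G -> 'I_r).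

Definition colour_pairs (U W : {set G}) (a : 'I_r) : {set G * G} :=
  [set p | [&& p.1 \in U, p.2 \in W & colour_adj c a p.1 p.2]].

Lemma colour_pairs_swap U W a : #|colour_pairs U W a| = #|colour_pairs W U a|.
Proof.
pose swap (p : G * G) := (p.2, p.1).
have swapK : involutive swap by case.
rewrite -(card_imset _ (inv_inj swapK)); apply: eq_card => p.
rewrite -[p]swapK mem_imset; last exact: inv_inj.
by rewrite !inE /= colour_adj_sym andbCA.
Qed.

Variables (I : finType) (E : {set I}) (X : I -> {set 'I_r}) (W : I -> {set G}).
Variable m : nat.

(** Otherwise each pair of sets is sparse in every colour, since a colour cannot
    be in both [X i] and [X j]. Then the sets have a transversal that is
    independent, and larger than the independence number. *)
Lemma dense_colour_pair (L := 16 * #|E| ^ 2 * r) :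
  independence_number G < #|E| ->
  {in E &, forall i j, i != j -> [disjoint X i & X j]} ->
  (forall i, i \in E -> #|W i| = m) -> 0 < r -> L <= m ->
  exists i j a, [/\ i \in E, j \in E, a \notin X i &
    m ^ 2 <= L * #|colour_pairs (W i) (W j) a|].
Proof.
move=> indep Xdis Wm r_gt0 Lm; apply: contrapT => sparse.
set k := #|E| in indep L Lm sparse.
have k_gt0 : 0 < k by apply: leq_ltn_trans indep.
have L_gt0 : 0 < L by rewrite /L !muln_gt0 ?expn_gt0 ?k_gt0 ?r_gt0.
have sparse1 i j a : i \in E -> j \in E -> a \notin X i ->
    #|colour_pairs (W i) (W j) a| <= m ^ 2 %/ L.
  move=> iE jE aX; rewrite leq_divRL // mulnC leqNgt; apply/negP => /ltnW big.
  by apply: sparse; exists i, j, a.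
have sparse2 i j a : i \in E -> j \in E -> i != j ->
    #|colour_pairs (W i) (W j) a| <= m ^ 2 %/ L.
  move=> iE jE ij; have [aXi|] := boolP (a \in X i); last exact: sparse1.
  rewrite colour_pairs_swap; apply: sparse1 => //.
  by rewrite (disjointFr (Xdis i j iE jE ij)).
(* Equality is included in the relation because the sets W i may overlap: this
   makes the elements of the transversal distinct. *)
pose e : rel G := fun x y => (x == y) || adj x y.
have e_sym : symmetric e by move=> x y; rewrite /e eq_sym adj_sym.
(* With these values k * (h + d) <= m / 2 + m / 4 + k < m. *)
pose h := m %/ (2 * k); pose d := (m %/ (4 * k)).+1.
have edges_few i j : i \in E -> j \in E -> i != j ->
    8 * k ^ 2 * #|[set p : G * G | [&& p.1 \in W i, p.2 \in W j & e p.1 p.2]]| <= m ^ 2.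
  move=> iE jE ij; set Q := [set p | _].
  pose M := \bigcup_(a : 'I_r) colour_pairs (W i) (W j) a.
  have QS : Q \subset [set (x, x) | x in W i] :|: M.
    apply/subsetP => -[x y]; rewrite !inE /= => /and3P[xW yW /orP[/eqP <-|xy]].
      by rewrite imset_f.
    have [a axy] := adj_colour c xy; apply/orP; right; apply/bigcupP; exists a => //.
    by rewrite inE /= xW yW.
  have [Q1 _] := leq_card_setU [set (x, x) | x in W i] M.
  have Q2 := subset_leq_card QS.
  have Q3 : #|[set (x, x) | x in W i]| <= m by rewrite -(Wm i iE) leq_imset_card.
  have Q4 : #|M| <= r * (m ^ 2 %/ L).
    rewrite -[r in r * _]card_ord.
    by apply: leq_card_bigcup => a _; apply: sparse2.
  have Q5 : #|Q| <= m + r * (m ^ 2 %/ L).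
    by apply: leq_trans Q2 (leq_trans Q1 _); apply: leq_add.
  have Q6 : L * #|Q| <= r * m ^ 2 + r * m ^ 2.
    apply: leq_trans (leq_mul (leqnn L) Q5) _; rewrite mulnDr leq_add //.
      rewrite -[L * m]mul1n leq_mul // expnS expn1 leq_mul //.
    by rewrite mulnCA leq_mul // mulnC leq_divM.
  have: (2 * r) * (8 * k ^ 2 * #|Q|) <= (2 * r) * m ^ 2.
    by move: Q6; rewrite /L; lia.
  by rewrite leq_pmul2l // muln_gt0.
have md : m < 4 * k * d by rewrite mulnC ltn_ceil // muln_gt0.
have heavy i j : i \in E -> j \in E -> i != j ->
    #|[set x in W i | d <= #|[set y in W j | e x y]|]| <= h.
  move=> iE jE ij; have := high_degree_count e (W i) (W j) d.
  have := edges_few i j iE jE ij; set H := #|[set x in W i | _]|; set Q := #|_|.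
  move=> Qm HQ; rewrite /h leq_divRL ?muln_gt0 // leqNgt; apply/negP => mH.
  have : m * m < (H * (2 * k)) * (4 * k * d) by apply: ltn_mul.
  have : (8 * k ^ 2) * (H * d) <= (8 * k ^ 2) * Q by rewrite leq_mul.
  by move: Qm; rewrite -!mulnn; move: (8 * (k * k) * Q) => z; lia.
have [x0 _] : exists x0 : G, x0 \in [set: G].
  have [i iE] := card_gt0P k_gt0.
  have : 0 < #|W i| by rewrite Wm //; apply: leq_trans Lm.
  by case/card_gt0P => x; exists x; rewrite inE.
have kL : 16 * k <= m.
  apply: leq_trans Lm; rewrite /L -mulnA leq_mul // -mulnn -mulnA.
  by rewrite leq_pmulr // muln_gt0 k_gt0.
have [i iE|v [vW vind]] := sparse_transversal (W := W) (h := h) (d := d) x0 e_sym heavy.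
  rewrite Wm // -/k mulnDr.
  have : k * h * 2 <= m.
    by rewrite mulnAC mulnC [k * 2]mulnC; apply: leq_divM.
  have : k * (m %/ (4 * k)) * 4 <= m.
    by rewrite mulnAC mulnC [k * 4]mulnC; apply: leq_divM.
  by rewrite /d mulnS; lia.
have vinj : {in E &, injective v}.
  move=> i j iE jE vij; apply/eqP; apply: contraT => ij.
  by have := vind i j iE jE ij; rewrite /e vij eqxx.
have Bind : @independent G (v @: E).
  apply/forall_inP => _ /imsetP[i iE ->]; apply/forall_inP => _ /imsetP[j jE ->].
  have [->|ij] := eqVneq i j; first by rewrite adj_irr.
  by have := vind i j iE jE ij; rewrite negb_or => /andP[].
move: indep; rewrite ltnNge => /negP; apply.
rewrite /k -(card_in_imset vinj).
exact: (@leq_bigmax_cond _ (@independent G) (fun A : {set G} => #|A|) _ Bind).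
Qed.

(** The graph of colour [a] between [U] and [V] has average degree of order
    m / L, hence a subgraph with minimum degree about m / (8 * L), and a cycle at
    least that long, of which at least about half lies in [U]. *)
Lemma dense_pair_cycle (U V : {set G}) a L :
  0 < L -> 16 * L <= m -> #|U| = m -> #|V| = m ->
  m ^ 2 <= L * #|colour_pairs U V a| ->
  exists p : seq G, [/\ uniq p, cycle (colour_adj c a) p, 2 < size p &
    m <= 64 * L * #|[set x in U | x \in p]|].
Proof.
move=> L_gt0 Lm Um Vm dens.
pose e : rel G := fun x y =>
  colour_adj c a x y && ((x \in U) && (y \in V) || (y \in U) && (x \in V)).
have e_sym : symmetric e by move=> x y; rewrite /e colour_adj_sym orbC.
have e_irr : irreflexive e by move=> x; rewrite /e colour_adj_irr.
pose d := m %/ (8 * L).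
have d_ge2 : 2 <= d by rewrite /d leq_divRL ?muln_gt0 // mulnA.
have dm : d * (8 * L) <= m by apply: leq_divM.
have [|B B_gt0 Bdeg] := dense_min_degree e_sym (A := U :|: V) (d := d).
  have UV : #|U :|: V| <= m + m by rewrite -{1}Um -Vm leq_card_setU.
  have sub : colour_pairs U V a \subset
      [set p | [&& p.1 \in U :|: V, p.2 \in U :|: V & e p.1 p.2]].
    apply/subsetP => -[x y]; rewrite !inE /= /e => /and3P[-> -> ->].
    by rewrite orbT.
  apply: leq_trans (subset_leq_card sub).
  rewrite -(ltn_pmul2l L_gt0); apply: leq_trans dens.
  have m_gt0 : 0 < m by lia.
  have : L * (2 * d * #|U :|: V|) <= L * (2 * d * (m + m)) by rewrite !leq_mul.
  have : (d * (8 * L)) * m <= m * m by rewrite leq_mul.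
  have : 0 < m * m by rewrite muln_gt0 m_gt0.
  by rewrite -mulnn; lia.
have [p [p_uniq p_cycle dp]] := min_degree_cycle e_sym e_irr B_gt0 (ltnW d_ge2) Bdeg.
exists p; split=> //.
- by apply: sub_cycle p_cycle => x y /andP[].
- exact: leq_ltn_trans dp.
have -> : #|[set x in U | x \in p]| = count (mem U) p.
  rewrite -size_filter -(card_uniqP (filter_uniq _ p_uniq)).
  by apply: eq_card => x; rewrite inE mem_filter.
case: p p_uniq p_cycle dp => [//|x p] _ /=; rewrite rcons_path => /andP[p_path _] dp.
have cnt := @path_vertex_cover_count _ e (mem U) x p _ p_path.
have {}cnt : size (x :: p) <= (2 * count (mem U) (x :: p)).+1.
  by apply: cnt => u v /andP[_ /orP[]/andP[/= -> _]]; rewrite ?orbT.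
rewrite /= in cnt dp.
have md : m < d.+1 * (8 * L) by rewrite ltn_ceil // muln_gt0.
set n := (_ + count _ _) in cnt *.
have dn : d <= 2 * n by lia.
have dn2 : d.+1 <= 8 * n by lia.
apply: ltnW; apply: leq_trans md _.
by apply: leq_trans (leq_mul dn2 (leqnn _)) _; lia.
Qed.

End DensePair.

(** * The upper bound *)

Lemma kneser_card_gt0 r m : m <= r -> 0 < #|{: kneser_vertex r m}|.
Proof.
move=> mr; have [Z _ /eqP Zcard] : exists2 Z : {set 'I_r}, Z \subset setT & #|Z| = m.
  by apply: subset_of_card; rewrite cardsT card_ord.
by apply/card_gt0P; exists (Sub Z Zcard).
Qed.

Lemma kneser_chromatic_gt0 alpha r m : 0 < alpha -> m <= r ->
  0 < chromatic_number (kneser_hypergraph alpha.+1 r m).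
Proof.
move=> alpha_gt0 mr; set K := kneser_hypergraph _ _ _.
have hyp e : e \in hyperedge K -> 1 < #|e| by apply: kneser_hyperedge_gt1.
have [[f _] _] := chromatic_numberP hyp.
have /card_gt0P[Y _] := kneser_card_gt0 mr.
exact: leq_ltn_trans (ltn_ord (f Y)).
Qed.

(** Partial coverings without the colours of [X], the set of the colours given
    up: once nothing is left uncovered, the bound on the number of colours is
    automatic. *)
Section PartialCoverings.
Variables (r : nat) (G : graph) (c : edge G -> 'I_r) (X : {set 'I_r}).

Definition mono_cycle (H : presubgraph G) : Prop :=
  [/\ is_subgraph H, monochromatic c H &
    exists2 K, Fcycles K & isomorphic (graph_of_sub H) K].

Definition avoids (H : presubgraph G) : Prop :=
  forall e, val e \in H.2 -> c e \notin X.

Definition covers_outside (U : {set G}) (k : nat) : Prop :=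
  exists S : {set presubgraph G}, [/\ #|S| <= k,
    forall H, H \in S -> mono_cycle H /\ avoids H &
    forall x, x \notin U -> exists2 H, H \in S & x \in H.1].

Lemma covers_outside_all : covers_outside setT 0.
Proof. by exists set0; split=> [|H|x]; rewrite ?cards0 ?inE. Qed.

Lemma covers_outside_add U k H : covers_outside U k -> mono_cycle H ->
  avoids H -> covers_outside (U :\: H.1) k.+1.
Proof.
move=> [S [Sk SH Scov]] Hm Ha; exists (H |: S); split.
- by rewrite cardsU1 -add1n leq_add ?leq_b1.
- by move=> H'; rewrite !inE => /orP[/eqP->|/SH].
- move=> x; rewrite inE negb_and negbK => /orP[xH|/Scov[H' H'S xH']].
    by exists H; rewrite ?inE ?eqxx.
  by exists H'; rewrite // inE H'S orbT.
Qed.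

Lemma mono_cycle_seq a p : a \notin X -> uniq p ->
  cycle (colour_adj c a) p -> 2 < size p ->
  exists H : presubgraph G, [/\ mono_cycle H, avoids H & H.1 = [set x in p]].
Proof.
move=> aX p_uniq p_cycle p_size.
pose g : cycle_graph (size p) -> G := tnth (in_tuple p).
have ginj : injective g by apply/tuple_uniqP.
have gS (i j : 'I_(size p)) : i.+1 %% size p = j -> colour_adj c a (g i) (g j).
  case: p @g ginj p_cycle p_uniq p_size i j => [//|x p] g _ /= /pathP p_path _ _ i j ij.
  have := p_path x i; rewrite size_rcons => /(_ (ltn_ord i)).
  rewrite /g !(tnth_nth x) /= -ij nth_rcons.
  have -> : nth x (x :: rcons p x) i = nth x (x :: p) i.
    by rewrite -rcons_cons nth_rcons ltn_ord.
  have := ltn_ord i; rewrite ltnS leq_eqVlt => /orP[/eqP->|ip].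
    by rewrite ltnn eqxx modnn.
  by rewrite ip modn_small.
have ghom i j : adj i j -> colour_adj c a (g i) (g j).
  by case/andP=> _ /orP[]/eqP/gS //; rewrite colour_adj_sym.
exists (embed g); split.
- split; [exact: embed_subgraph ghom|exact: embed_monochromatic ghom|].
  exists (cycle_graph (size p)); last exact: embed_isomorphic.
  by constructor 3; exists (size p) => //; apply: isomorphic_refl.
- by move=> e /(embed_colour ghom)->.
- apply/setP => x; rewrite inE; apply/imsetP/idP => [[i _ ->]|xp].
    exact: (mem_tnth i (in_tuple p)).
  by have /tnthP[i ->] : x \in in_tuple p by []; exists i.
Qed.

Lemma mono_cycle_vertex x :
  exists H : presubgraph G, [/\ mono_cycle H, avoids H & H.1 = [set x]].
Proof.
pose g : complete_graph 1 -> G := fun=> x.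
have ginj : injective g by move=> i j _; rewrite (ord1 i) (ord1 j).
have noadj (i j : complete_graph 1) : adj i j = false.
  by rewrite (ord1 i) (ord1 j) adj_irr.
have noedge A : A \notin (embed g).2.
  by apply/imsetP => -[[i j]]; rewrite inE noadj.
exists (embed g); split.
- split.
  + split; apply/subsetP => y; first by rewrite (negbTE (noedge y)).
    by case/bigcupP => A; rewrite (negbTE (noedge A)).
  + by move=> e1 e2; rewrite (negbTE (noedge _)).
  + exists (complete_graph 1); first exact: Fcycles_K1.
    exact: embed_isomorphic.
- by move=> e; rewrite (negbTE (noedge _)).
- apply/setP => y; rewrite inE; apply/imsetP/eqP => [[i _ ->] //|->].
  by exists ord0.
Qed.

Lemma covers_outside_vertices U k :
  covers_outside U k -> covers_outside set0 (k + #|U|).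
Proof.
move: {2}#|U| (erefl #|U|) => u; elim: u U k => [|u IH] U k Uu cov.
  by rewrite Uu addn0; move/eqP: Uu cov; rewrite cards_eq0 => /eqP->.
have [x xU] : exists x, x \in U by apply/card_gt0P; rewrite Uu.
have [H [Hm Ha HE]] := mono_cycle_vertex x.
have Ux : #|U :\ x| = u by move: Uu; rewrite (cardsD1 x) xU => -[].
have := covers_outside_add cov Hm Ha; rewrite HE => /(IH _ _ Ux).
by rewrite Ux Uu addSnnS.
Qed.

End PartialCoverings.

(** For t^q < u <= t^(q+1), covering t^q / D further vertices lowers the term of
    index q by at least t^chi / D, and [D * potential] by at least t^chi. So t^chi
    is the price of one cycle, whatever the scale. The factors t^(chi - q) stand for
    division by t^q, and keep the potential integral. *)
Definition potential (chi t u : nat) : nat :=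
  \sum_(q < chi) minn u (t ^ q.+1) * t ^ (chi - q).

Lemma potential_le chi t u : potential chi t u <= chi * t ^ chi.+1.
Proof.
rewrite -[chi in chi * _]card_ord -sum_nat_const; apply: leq_sum => q _.
apply: leq_trans (leq_mul (geq_minr _ _) (leqnn _)) _.
by rewrite -expnD addSn subnKC // ltnW.
Qed.

Lemma potential_decrease chi t D u u' z q : q < chi ->
  u' + z <= u <= t ^ q.+1 -> t ^ q <= D * z ->
  t ^ chi + D * potential chi t u' <= D * potential chi t u.
Proof.
move=> qchi /andP[uz ut] Dz; rewrite /potential.
rewrite (bigD1 (Ordinal qchi)) //= [X in _ <= D * X](bigD1 (Ordinal qchi)) //=.
rewrite !mulnDr addnA leq_add //.
  rewrite (minn_idPl ut) (minn_idPl (leq_trans _ ut)); last by lia.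
  have -> : t ^ chi = t ^ q * t ^ (chi - q) by rewrite -expnD subnKC // ltnW.
  rewrite !mulnA -mulnDl leq_mul2r; apply/orP; right.
  by apply: leq_trans (leq_mul (leqnn D) uz); rewrite mulnDr addnC leq_add2l.
rewrite leq_mul2l; apply/orP; right; apply: leq_sum => i _.
by rewrite leq_mul2r leq_min geq_minr andbT (leq_trans (geq_minl _ _)) ?orbT //; lia.
Qed.

(** As long as every [U Y] is larger than [t], their scales q range over
    1, ..., chi - 1, and a colouring of the Kneser hypergraph with that many
    colours is not proper. A hyperedge of one scale gives alpha + 1 disjoint sets Y,
    and subsets of equal size of their [U Y], among which a dense pair is found. *)
Lemma exists_long_cycle_step r s alpha (G : graph) (c : edge G -> 'I_r) t
    (K := kneser_hypergraph alpha.+1 r (r - s)) (chi := chromatic_number K)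
    (L := 16 * alpha.+1 ^ 2 * r) (U : K -> {set G}) :
  0 < alpha -> s < r -> independence_number G <= alpha -> 16 * L <= t ->
  #|G| <= t ^ chi -> (forall Y, t < #|U Y|) ->
  exists Y q H, [/\ q < chi, t ^ q < #|U Y| <= t ^ q.+1,
    mono_cycle c H /\ avoids c (val Y) H & t ^ q <= 64 * L * #|U Y :&: H.1|].
Proof.
move=> alpha_gt0 s_lt_r indep tL Gt Ubig.
have r_gt0 : 0 < r by apply: leq_ltn_trans s_lt_r.
have hyp e : e \in hyperedge K -> 1 < #|e| by apply: kneser_hyperedge_gt1.
have [_ chi_min] := chromatic_numberP hyp; rewrite -/chi in chi_min.
have L_gt0 : 0 < L by rewrite /L !muln_gt0 ?expn_gt0 ?r_gt0.
have t_gt1 : 1 < t by lia.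
pose scale Y := (up_log t #|U Y|).-1.
have scaleP Y : t ^ scale Y < #|U Y| <= t ^ (scale Y).+1 /\ 0 < scale Y < chi.
  have lg : 1 < up_log t #|U Y|.
    rewrite ltnNge; apply/negP => lg; have := Ubig Y; rewrite ltnNge => /negP; apply.
    apply: leq_trans (up_logP _ t_gt1) _.
    by rewrite -[leqRHS]expn1 leq_pexp2l // ltnW.
  have lgS : (scale Y).+1 = up_log t #|U Y| by rewrite /scale prednK // ltnW.
  have lgchi : up_log t #|U Y| <= chi.
    by apply: up_log_min => //; apply: leq_trans (max_card _) Gt.
  split; last by move: lgchi; rewrite -lgS => ->; rewrite -ltnS lgS lg.
  rewrite lgS up_logP // andbT /scale.
  exact: up_log_gtn (ltn_trans t_gt1 (Ubig Y)).
have scale_lt Y : (scale Y).-1 < chi.-1 by have [_] := scaleP Y; lia.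
have chi_gt0 : 0 < chi by apply: kneser_chromatic_gt0 => //; apply: leq_subr.
pose f (Y : K) : 'I_chi.-1 := Ordinal (scale_lt Y).
have /existsNP[e] : ~ @proper_colouring K chi.-1 f.
  move=> fP; have := chi_min chi.-1.
  by rewrite leqNgt prednK // leqnn => /(_ (ex_intro _ f fP)).
move=> /not_implyP[eK /contrapT[a fa]].
have [Y0 Y0e] : exists Y, Y \in e by apply/card_gt0P/ltnW/hyp.
have scale_e Y : Y \in e -> scale Y = scale Y0.
  move=> Ye; have := fa Y Ye; rewrite -(fa Y0 Y0e) => /(congr1 val) /=.
  have [_] := scaleP Y; have [_] := scaleP Y0; lia.
move: eK; rewrite inE => /andP[/eqP ecard edis].
set q := scale Y0 in scale_e.
have /choice[W WP] (Y : K) : exists W : {set G}, Y \in e -> W \subset U Y /\ #|W| = t ^ q.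
  have [Ye|_] := boolP (Y \in e); last by exists set0.
  have [W WU Wq] : exists2 W : {set G}, W \subset U Y & #|W| = t ^ q.
    by apply: subset_of_card; rewrite -(scale_e Y Ye); have [/andP[/ltnW]] := scaleP Y.
  by exists W.
have [/andP[]] := scaleP Y0; rewrite -/q => _ _ /andP[q_gt0 qchi].
have tq : t <= t ^ q by rewrite -{1}[t]expn1 leq_pexp2l // ltnW.
have [|||//||i [j [b [ie je bi dens]]]] :=
  @dense_colour_pair r G c _ e (fun Y : K => val Y) W (t ^ q).
- by rewrite ecard ltnS.
- by move=> i j ie je ij; move/forall_inP/(_ i ie)/forall_inP/(_ j je): edis; rewrite ij.
- by move=> Y /WP[].
- by rewrite ecard; apply: leq_trans tq; apply: leq_trans tL; rewrite leq_pmull.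
rewrite ecard -/L in dens.
have [WiU Wi] := WP i ie; have [_ Wj] := WP j je.
have [p [p_uniq p_cycle p_size pm]] :=
  dense_pair_cycle L_gt0 (leq_trans tL tq) Wi Wj dens.
have [H [Hm Ha HE]] := mono_cycle_seq bi p_uniq p_cycle p_size.
exists i, q, H; split=> //; first by rewrite -(scale_e i ie); case: (scaleP i).
apply: leq_trans pm _; rewrite leq_mul2l; apply/orP; right.
apply/subset_leq_card/subsetP => x; rewrite !inE HE inE => /andP[xW ->].
by rewrite (subsetP WiU).
Qed.

(** [state Y U] holds when [U] can be left uncovered at a price paid by the drop
    of the potential. A state that minimises #|U| for each [Y] cannot be improved,
    so by [exists_long_cycle_step] some #|U| is at most [t]. *)
Lemma cover_number_upper_bound r s alpha (G : graph) t
    (K := kneser_hypergraph alpha.+1 r (r - s)) (chi := chromatic_number K)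
    (L := 16 * alpha.+1 ^ 2 * r) :
  0 < alpha -> s < r -> independence_number G <= alpha -> 16 * L <= t ->
  #|G| <= t ^ chi ->
  coverable r s G Fcycles ((64 * L * chi).+1 * t).
Proof.
move=> alpha_gt0 s_lt_r indep tL Gt c.
have r_gt0 : 0 < r by apply: leq_ltn_trans s_lt_r.
have L_gt0 : 0 < L by rewrite /L !muln_gt0 ?expn_gt0 ?r_gt0.
have t_gt0 : 0 < t by lia.
set D := 64 * L.
pose state (Y : K) (U : {set G}) := exists k,
  covers_outside c (val Y) U k /\
  k * t ^ chi + D * potential chi t #|U| <= D * (chi * t ^ chi.+1).
have state0 Y : state Y setT.
  exists 0; split; first exact: covers_outside_all.
  by rewrite mul0n add0n leq_mul // potential_le.
have /choice[U UP] (Y : K) :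
    exists U, state Y U /\ forall U', state Y U' -> #|U| <= #|U'|.
  have ex : exists u, `[< exists2 U, state Y U & #|U| = u >].
    by exists #|[set: G]|; apply/asboolP; exists setT.
  case: (ex_minnP ex) => u /asboolP[U YU Uu] umin; exists U; split=> // U' YU'.
  by rewrite Uu; apply: umin; apply/asboolP; exists U'.
have [Y Ysmall] : exists Y, #|U Y| <= t.
  apply: contrapT => /forallNP Ubig.
  have {}Ubig Y : t < #|U Y| by rewrite ltnNge; apply/negP.
  have [Y [q [H [qchi /andP[_ Uq] [Hm Ha] tq]]]] :=
    exists_long_cycle_step c alpha_gt0 s_lt_r indep tL Gt Ubig.
  have [[k [Yk kpot]] Ymin] := UP Y.
  have Ucard : #|U Y :\: H.1| + #|U Y :&: H.1| = #|U Y| by rewrite addnC cardsID.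
  have dec := @potential_decrease chi t D #|U Y| #|U Y :\: H.1| #|U Y :&: H.1| q qchi.
  rewrite Ucard leqnn Uq in dec.
  have {}dec := dec isT tq.
  have : state Y (U Y :\: H.1).
    exists k.+1; split; first exact: covers_outside_add.
    by apply: leq_trans kpot; rewrite mulSnr -addnA leq_add2l.
  move/Ymin; rewrite -Ucard -[leqRHS]addn0 leq_add2l leqn0 => /eqP U0.
  by move: tq; rewrite U0 muln0 leqn0 expn_eq0 -[t == 0]negbK -lt0n t_gt0.
have [[k [Yk kpot]] _] := UP Y.
have {kpot} kt : k <= D * chi * t.
  have tchi : 0 < t ^ chi by rewrite expn_gt0 t_gt0.
  rewrite -(leq_pmul2r tchi) -mulnA -mulnA -expnS.
  by apply: leq_trans kpot; rewrite leq_addr.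
have [S [Sk SH Scov]] := covers_outside_vertices Yk.
exists S; split.
- by split=> [H /SH[]//|x]; apply: Scov; rewrite inE.
- apply: leq_trans Sk _; rewrite mulSn addnC leq_add //.
- apply: leq_trans (_ : #|~: val Y| <= _).
    apply/subset_leq_card/subsetP => a /imsetP[e]; rewrite inE.
    move=> /existsP[H /andP[/SH[_ Ha] eH]] ->; rewrite inE.
    exact: Ha.
  by rewrite cardsCs setCK card_ord (eqP (valP Y)) leq_subCl.
Qed.

(** * Asymptotics *)

Local Open Scope ring_scope.

Lemma powR_root_floor (R : realType) (n k : nat) : (0 < k)%N ->
  exists t : nat, [/\ t%:R <= (n%:R : R) `^ (k%:R^-1), (n%:R : R) `^ (k%:R^-1) < t.+1%:R,
    (t ^ k <= n)%N & (n < t.+1 ^ k)%N].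
Proof.
move=> k_gt0; set x := _ `^ _.
have x_ge0 : 0 <= x by apply: powR_ge0.
have xk : x ^+ k = n%:R.
  by rewrite -powR_mulrn // -powRrM mulVf ?powRr1 // pnatr_eq0 -lt0n.
have /andP[tx xt] := truncn_itv x_ge0.
exists (Num.truncn x); split=> //.
  by rewrite -(ler_nat R) natrX -xk lerXn2r // nnegrE.
by rewrite -(ltr_nat R) natrX -xk ltrXn2r // -lt0n.
Qed.

Theorem corollary3 (R : realType) (r s alpha : nat)
    (r_gt0 : (0 < r)%N) (s_gt0 : (0 < s)%N) (alpha_gt0 : (0 < alpha)%N)
    (s_lt_r : (s < r)%N) :
  let chi := chromatic_number (kneser_hypergraph alpha.+1 r (r - s)%N) in
  exists c C : R,
    [/\ 0 < c, 0 < C &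
        exists N : nat, forall n : nat, (N <= n)%N ->
          [/\ c * ((n%:R : R) `^ (chi%:R^-1))
                <= (max_cover_number r s alpha n Fpaths)%:R,
              (max_cover_number r s alpha n Fpaths
                <= max_cover_number r s alpha n Fcycles)%N &
              (max_cover_number r s alpha n Fcycles)%:R
                <= C * ((n%:R : R) `^ (chi%:R^-1))]].
Proof.
move=> chi.
have chi_gt0 : (0 < chi)%N by apply: kneser_chromatic_gt0 => //; apply: leq_subr.
pose K := #|{: kneser_vertex r (r - s)%N}|.
have K_gt0 : (0 < K)%N by apply/kneser_card_gt0/leq_subr.
pose L := (16 * alpha.+1 ^ 2 * r)%N.
pose D := (64 * L * chi).+1%N.
exists (2 * K * K.+1)%:R^-1, (2 * D)%:R.
split; [by rewrite invr_gt0 ltr0n !muln_gt0 K_gt0|by rewrite ltr0n|].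
exists ((K + 16 * L) ^ chi)%N => n n_big.
have [t [tx xt tn nt]] := powR_root_floor R n chi_gt0.
move: ((n%:R : R) `^ _) tx xt => x tx xt.
have t_big : (K + 16 * L < t.+1)%N.
  by rewrite -(ltn_exp2r _ _ chi_gt0); apply: leq_ltn_trans nt.
split.
- (* Division by K makes the cliques of all K sets fit in n vertices. *)
  pose u := (t %/ K)%N.
  have u_gt0 : (0 < u)%N by rewrite divn_gt0 //; lia.
  have uK : (u * K <= t)%N by apply: leq_divM.
  have tu : (t < u.+1 * K)%N by rewrite ltn_ceil.
  have un : (K * u ^ chi <= n)%N.
    apply: leq_trans tn; apply: leq_trans (_ : (u * K) ^ chi <= _)%N;
      last by rewrite leq_exp2r.
    by rewrite expnMn mulnC leq_mul // -{1}[K]expn1 leq_pexp2l.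
  have lower := cover_number_lower_bound alpha_gt0 s_lt_r u_gt0 un.
  rewrite mulrC ler_pdivrMr ?ltr0n ?muln_gt0 ?K_gt0 //.
  apply: le_trans (ltW xt) _; rewrite -natrM ler_nat.
  apply: leq_trans tu _; apply: leq_trans (_ : 2 * K * u <= _)%N.
    by rewrite mulnAC leq_mul2r mul2n -addnn -addn1 leq_add2l u_gt0 orbT.
  by rewrite mulnCA leq_mul.
- exact: max_cover_paths_le_cycles.
- have [[G [nG aG ->]] _] := max_cover_numberP r s n alpha_gt0 Fcycles_K1.
  have [_ Gmin] := cover_numberP r s G Fcycles_K1.
  have Gt : (#|G| <= t.+1 ^ chi)%N by rewrite nG ltnW.
  have tL : (16 * L <= t.+1)%N by apply: leq_trans (ltnW t_big); apply: leq_addl.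
  have /Gmin upper := cover_number_upper_bound alpha_gt0 s_lt_r aG tL Gt.
  apply: le_trans (_ : (D * t.+1)%:R <= _); first by rewrite ler_nat.
  apply: le_trans (_ : (2 * D * t)%:R <= _).
    by rewrite ler_nat [(2 * D)%N]mulnC -mulnA leq_mul //; lia.
  by rewrite natrM ler_wpM2l.
Qed.
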